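(* Let $n\ge2$, let $u_0,\dots,u_{n-2}$ be unitaries on $(\mathbb{C}^2)^{\otimes n}$ with $u_t$ acting on qubits $t,t+1$, and $u_{n-1}=c\,\mathbb{1}$ with $|c|=1$. Set $U_{t:0}=u_{t-1}\cdots u_0$ ($U_{0:0}=\mathbb{1}$), and for an increasing tuple $\mathbf t=(t_1<\dots<t_m)$ in $\{0,\dots,n-1\}$ set $U_{\mathbf t:0}=U_{t_1:0}U_{t_2:0}\cdots U_{t_m:0}$ and $c_{\mathbf t}^\dagger=c_{t_1}^\dagger\cdots c_{t_m}^\dagger$, where $c_0,\dots,c_{n-1}$ are spinless fermion modes with vacuum $|\Omega\rangle$. Let $U_{n:0}|\phi\rangle=e^{i\phi}|\phi\rangle$. For distinct momenta $\mathbf k=(k_1,\dots,k_M)$ with $k_j\in\frac{2\pi}{n}\{0,\dots,n-1\}$, let $$c^\dagger_{\mathbf k,\phi}=\prod_{k\in\mathbf k}\Big[\tfrac{1}{\sqrt n}\sum_{t=0}^{n-1}e^{i(k-\phi/n)t}c_t^\dagger\Big],$$ write $c^\dagger_{\mathbf k,\phi}|\Omega\rangle=\sum_{\mathbf t}\varphi_{\mathbf k,\phi}(\mathbf t)\,c_{\mathbf t}^\dagger|\Omega\rangle$ (sum over increasing $M$-tuples), and define the eigenstate of the many-hand periodic clock Hamiltonian $H=\sum_{t=0}^{n-1}[\mathbb{1}\otimes c_t^\dagger c_t-\frac12(u_t\otimes c^\dagger_{t+1}c_t+\mathrm{h.c.})]$ ($c_n\equiv c_0$) $$|\Psi_{\mathbf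 k,\phi}\rangle=\sum_{\mathbf t}\varphi_{\mathbf k,\phi}(\mathbf t)\,U_{\mathbf t:0}|\phi\rangle\otimes c_{\mathbf t}^\dagger|\Omega\rangle .$$ Let $A$ consist of the qubits and fermion modes at the sites of a cyclic interval of $\{0,\dots,n-1\}$. Then $$S^{(2)}_A(|\Psi_{\mathbf k,\phi}\rangle)\ \ge\ S^{(2)}_A(c^\dagger_{\mathbf k,\phi}|\Omega\rangle)+\min_{\mathbf t}S^{(2)}_A(U_{\mathbf t:0}|\phi\rangle),$$ where the minimum runs over increasing tuples $\mathbf t$ with at most $M$ entries, and in the last term $A$ denotes its set of qubits.
   Context: The second Rényi entropy is $S^{(2)}_A(|\Psi\rangle)=-\ln\mathrm{Tr}(\rho_A^2)$, with $\rho_A$ the reduced density matrix of $|\Psi\rangle$ on $A$ (for fermionic modes, via the standard fermionic partial trace, equivalently Jordan–Wigner two-level sites). *)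

(* Defs.v *)
From mathcomp Require Import all_boot all_order all_algebra.
From mathcomp Require Import all_classical all_reals all_analysis.
From mathcomp Require Import complex.


Import Order.TTheory GRing.Theory Num.Theory.
Local Open Scope ring_scope.

Section Defs.
Variable R : realType.
Local Notation C := R[i].

Definition expi (th : R) : C := (cos th +i* sin th)%C.

Definition conf (X : finType) (n : nat) := {ffun 'I_n -> X}.

Definition restr {X : finType} {n : nat} (A : {set 'I_n}) (c : conf X n)
  : {ffun {i : 'I_n | i \in A} -> X} := [ffun j => c (val j)].

(* the wave function seen as a function on (A-configurations) x (complement configurations) *)
Definition bipart {X : finType} {n : nat} (A : {set 'I_n}) (psi : conf X n -> C)
  (a : {ffun {i : 'I_n | i \in A} -> X}) (b : {ffun {i : 'I_n | i \in ~: A} -> X}) : C :=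
  \sum_(c : conf X n | (restr A c == a) && (restr (~: A) c == b)) psi c.

Definition rdm {X : finType} {n : nat} (A : {set 'I_n}) (psi : conf X n -> C)
  (a a' : {ffun {i : 'I_n | i \in A} -> X}) : C :=
  \sum_b bipart A psi a b * (bipart A psi a' b)^*.

Definition purity {X : finType} {n : nat} (A : {set 'I_n}) (psi : conf X n -> C) : C :=
  \sum_a \sum_a' rdm A psi a a' * rdm A psi a' a.

(* S^(2)_A = - ln Tr(rho_A^2)  (the trace is real; we take its real part) *)
Definition renyi2 {X : finType} {n : nat} (A : {set 'I_n}) (psi : conf X n -> C) : R :=
  - ln (complex.Re (purity A psi)).

Definition qconf n := conf bool n.
Definition qop n := qconf n -> qconf n -> C.  (* matrix entries <x|A|y> *)

Definition idop (n : nat) : qop n := fun x y => (x == y)%:R.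
Definition mulop {n : nat} (A B : qop n) : qop n := fun x y => \sum_z A x z * B z y.
Definition adjop {n : nat} (A : qop n) : qop n := fun x y => (A y x)^*.
Definition scaleop {n : nat} (a : C) (A : qop n) : qop n := fun x y => a * A x y.
Definition applyop {n : nat} (A : qop n) (v : qconf n -> C) : qconf n -> C :=
  fun x => \sum_y A x y * v y.

Definition unitary {n : nat} (A : qop n) : Prop :=
  mulop (adjop A) A = idop n /\ mulop A (adjop A) = idop n.

(* A acts only on qubits i and j: A = v_{ij} (x) identity on the other qubits *)
Definition acts_on2 {n : nat} (A : qop n) (i j : 'I_n) : Prop :=
  exists v : (bool * bool)%type -> (bool * bool)%type -> C,
    forall x y : qconf n,
      A x y = v (x i, x j) (y i, y j)
              * ([forall l, (l != i) && (l != j) ==> (x l == y l)])%:R.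

Fixpoint Uto {n : nat} (u : nat -> qop n) (t : nat) : qop n :=
  match t with
  | 0 => idop n
  | t'.+1 => mulop (u t') (Uto u t')
  end.

(* increasing tuples t = (t_1 < ... < t_m) are encoded by their underlying set S;
   enum S lists S in increasing order. *)
Definition Utup {n : nat} (u : nat -> qop n) (S : {set 'I_n}) : qop n :=
  foldr (fun (t : 'I_n) A => mulop (Uto u t) A) (idop n) (enum S).

(* ---------- spinless fermions (Jordan-Wigner two-level sites) ---------- *)
Definition fconf n := conf bool n.   (* occupation numbers *)
Definition fstate n := fconf n -> C.

Definition vac n : fstate n := fun o => (o == [ffun => false])%:R.

(* c_t^dagger |o'> = (-1)^{#{s < t : o'_s = 1}} |o' + e_t>  if o'_t = 0, and 0 otherwise *)
Definition cdag {n : nat} (t : 'I_n) (psi : fstate n) : fstate n := fun o =>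
  if o t then (-1) ^+ #|[set s : 'I_n | o s & (s < t)%N]|
              * psi [ffun s => if s == t then false else o s]
  else 0.

Definition ctup_vac {n : nat} (S : {set 'I_n}) : fstate n :=
  foldr (fun t v => cdag t v) (vac n) (enum S).

Definition finner {n : nat} (v w : fstate n) : C := \sum_o (v o)^* * w o.

(* momentum k = 2 pi m / n, m : 'I_n ; the mode
   (1/sqrt n) sum_t e^{i (k - phi/n) t} c_t^dagger *)
Definition bdag {n : nat} (phi : R) (m : 'I_n) (psi : fstate n) : fstate n := fun o =>
  ((Num.sqrt (n%:R : R))^-1)%:C%C *
  \sum_(t : 'I_n) expi ((2 * pi * m%:R / n%:R - phi / n%:R) * t%:R) * cdag t psi o.

Definition ckphi_vac {n : nat} (phi : R) (ks : seq 'I_n) : fstate n :=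
  foldr (fun m v => bdag phi m v) (vac n) ks.

Definition varphi {n : nat} (phi : R) (ks : seq 'I_n) (S : {set 'I_n}) : C :=
  finner (ctup_vac S) (ckphi_vac phi ks).

Definition qpart {n : nat} (c : conf (bool * bool)%type n) : qconf n := [ffun i => (c i).1].
Definition fpart {n : nat} (c : conf (bool * bool)%type n) : fconf n := [ffun i => (c i).2].

Definition Psi {n : nat} (u : nat -> qop n) (phi : R) (phivec : qconf n -> C)
  (ks : seq 'I_n) : conf (bool * bool)%type n -> C := fun c =>
  \sum_(S : {set 'I_n} | #|S| == size ks)
     varphi phi ks S * applyop (Utup u S) phivec (qpart c) * ctup_vac S (fpart c).

Definition cyc_interval n (i l : nat) : {set 'I_n} :=
  [set t : 'I_n | [exists j : 'I_n, (j < l)%N && (val t == (i + j) %% n)%N]].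

End Defs.

Arguments expi {R}.
Arguments restr {X n}.
Arguments bipart {R X n}.
Arguments rdm {R X n}.
Arguments purity {R X n}.
Arguments renyi2 {R X n}.
Arguments mulop {R n}.
Arguments adjop {R n}.
Arguments scaleop {R n}.
Arguments applyop {R n}.
Arguments unitary {R n}.
Arguments acts_on2 {R n}.
Arguments Uto {R n}.
Arguments Utup {R n}.
Arguments vac {R}.
Arguments cdag {R n}.
Arguments ctup_vac {R n}.
Arguments finner {R n}.
Arguments bdag {R n}.
Arguments ckphi_vac {R n}.
Arguments varphi {R n}.
Arguments Psi {R n}.

(* Main.v *)
(** Since [U_t] only involves gates on the sites [0..t], moving a hand from [t] to an
    unoccupied [t+1] multiplies [U_S phivec] on the left by the single gate [u_t]; moving
    it from [n-1] to [0] costs a phase, because [phivec] is an eigenvector of the full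
    cycle and [u_{n-1}] is scalar.  Hence rearranging hands inside [A] (or inside its
    complement, also a cyclic interval) is a local unitary which does not depend on the
    hands outside.  In the expansion of the purity of [Psi], particle number forces the
    four hand configurations of a nonvanishing term to have the same number [k] of hands
    in [A], so local unitaries turn the qubit factor into the purity [P_k] of any
    [U_S phivec] with [k] hands in [A].  Thus the purity of [Psi] is [sum_k p_k P_k], where
    [p_k >= 0] is the purity of the [k]-hands-in-[A] block of the fermion state and
    [sum_k p_k] its total purity; bounding every [P_k] by the largest one gives the claim.
    Logarithms of [0] are avoided by showing that the fermion state does not vanish,
    through the canonical anticommutation relations. *)

Require Import Defs.
From mathcomp Require Import all_boot all_order all_algebra.
From mathcomp Require Import all_classical all_reals all_analysis.
From mathcomp Require Import complex ring lra zify.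
From mathcomp Require Import finset.
Import Order.TTheory GRing.Theory Num.Theory.
Local Open Scope ring_scope.

(** * Purity of a bipartite state as a sum over pairs of configurations *)

Section Bipartite.
Context {R : realType} {X : finType} {n : nat}.
Local Notation C := R[i].
Implicit Types (A : {set 'I_n}) (x y z w : conf X n) (f g h k : conf X n -> C).

Definition mix A x y : conf X n := [ffun i => if i \in A then x i else y i].

Lemma restr_mix A x y : restr A (mix A x y) = restr A x.
Proof. by apply/ffunP => i; rewrite !ffunE (valP i). Qed.

Lemma restr_mixC A x y : restr (~: A) (mix A x y) = restr (~: A) y.
Proof.
by apply/ffunP => i; rewrite !ffunE; move: (valP i); rewrite inE => /negbTE ->.
Qed.

Lemma mixC A x y : mix (~: A) x y = mix A y x.
Proof. by apply/ffunP => i; rewrite !ffunE inE; case: (i \in A). Qed.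

Lemma restr_inj2 A x y :
  restr A x = restr A y -> restr (~: A) x = restr (~: A) y -> x = y.
Proof.
move=> /ffunP eA /ffunP eB; apply/ffunP => i; case: (boolP (i \in A)) => iA.
  by move: (eA (exist _ i iA)); rewrite !ffunE.
have iB : i \in ~: A by rewrite inE.
by move: (eB (exist _ i iB)); rewrite !ffunE.
Qed.

Lemma bipartE A f x : bipart A f (restr A x) (restr (~: A) x) = f x.
Proof.
rewrite /bipart (big_pred1 x) // => y /=.
apply/andP/eqP => [[/eqP e1 /eqP e2]|->]; last by rewrite !eqxx.
exact: (restr_inj2 A).
Qed.

Lemma bipart_mix A f x y : bipart A f (restr A x) (restr (~: A) y) = f (mix A x y).
Proof. by rewrite -(bipartE A) restr_mix restr_mixC. Qed.

Lemma glue_subproof A (a : {ffun {i : 'I_n | i \in A} -> X})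
    (b : {ffun {i : 'I_n | i \in ~: A} -> X}) :
  exists x, restr A x = a /\ restr (~: A) x = b.
Proof.
case: (boolP [exists x : conf X n, (restr A x == a) && (restr (~: A) x == b)]).
  by move=> /existsP [x /andP [/eqP e1 /eqP e2]]; exists x.
(* The glued value is specified against every membership proof, which avoids transporting the
   dependent arguments of [a] and [b]. *)
have D (i : 'I_n) : {v : X | (forall iA : i \in A, v = a (exist _ i iA)) /\
             (forall iB : i \in ~: A, v = b (exist _ i iB))}.
  have [iA|iA] : {i \in A} + {i \notin A} by case: (i \in A); [left|right].
    exists (a (exist _ i iA)); split => [iA'|iB]; first by rewrite (bool_irrelevance iA iA').
    by exfalso; move: iB; rewrite inE iA.
  have iB : i \in ~: A by rewrite inE.
  exists (b (exist _ i iB)); split => [iA'|iB']; first by rewrite iA' in iA.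
  by rewrite (bool_irrelevance iB iB').
move=> /existsP []; exists [ffun i => sval (D i)].
apply/andP; split; apply/eqP/ffunP => -[i iP]; rewrite !ffunE /=;
  by case: (D i) => v [] /=.
Qed.

(** The two restrictions form a bijection, so traces over the dependent index types of [rdm] become
    sums over whole configurations. *)
Lemma sum_restr (V : nmodType) A 
    (G : {ffun {i : 'I_n | i \in A} -> X} -> {ffun {i : 'I_n | i \in ~: A} -> X} -> V) :
  \sum_x G (restr A x) (restr (~: A) x) = \sum_a \sum_b G a b.
Proof.
rewrite pair_big /= (reindex (fun x => (restr A x, restr (~: A) x))) //=.
have [g gP] := boolp.choice (fun p => glue_subproof A p.1 p.2).
exists g => [x _|[a b] _] /=.
  by apply: (restr_inj2 A); case: (gP (restr A x, restr (~: A) x)).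
by case: (gP (a, b)) => /= -> ->.
Qed.

(* Tr_A[(Tr_B |f><g|)(Tr_B |h><k|)], so that the purity is its diagonal. *)
Definition swap_form A f g h k : C :=
  \sum_x \sum_y f x * h y * (g (mix A y x))^* * (k (mix A x y))^*.

Lemma purityE A f : purity A f = swap_form A f f f f.
Proof.
rewrite /purity /swap_form /rdm.
transitivity (\sum_a \sum_b \sum_a' \sum_b' (bipart A f a b * bipart A f a' b' *
   (bipart A f a' b)^* * (bipart A f a b')^*)).
  apply: eq_bigr => a _; rewrite exchange_big /=; apply: eq_bigr => a' _.
  rewrite big_distrlr /=; apply: eq_bigr => b _; apply: eq_bigr => b' _.
  rewrite -!mulrA; congr (_ * _); rewrite mulrCA; congr (_ * _); exact: mulrCA.
rewrite -(sum_restr _ A (fun a b => \sum_a' \sum_b' _)); apply: eq_bigr => x _.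
rewrite -(sum_restr _ A (fun a' b' => _ * bipart A f a' b' * (bipart A f a' _)^* * _)).
apply: eq_bigr => y _; by rewrite !bipartE !bipart_mix.
Qed.

(** Complementing [A] reverses every [mix], which exchanges the two conjugated arguments. Invariance
    under unitaries on [A] thus transfers to the complement. *)
Lemma swap_formC A f g h k : swap_form (~: A) f k h g = swap_form A f g h k.
Proof. by apply: eq_bigr => x _; apply: eq_bigr => y _; rewrite !mixC mulrAC. Qed.

Lemma swap_form_flip A f g h k : swap_form A h k f g = swap_form A f g h k.
Proof.
rewrite /swap_form exchange_big; apply: eq_bigr => x _; apply: eq_bigr => y _ /=.
by rewrite (mulrC (h _)) mulrAC.
Qed.

Lemma rdm_conj A f a a' : rdm A f a' a = (rdm A f a a')^*.
Proof.
rewrite /rdm rmorph_sum; apply: eq_bigr => b _.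
by rewrite rmorphM /= conjCK mulrC.
Qed.

Lemma purity_ge0 A f : 0 <= purity A f.
Proof.
apply: sumr_ge0 => a _; apply: sumr_ge0 => a' _.
by rewrite (rdm_conj _ _ a a') mul_conjC_ge0.
Qed.

(** The purity is a sum of squared moduli of entries of [rdm]. If it vanished, so would the diagonal
    entry at the [A]-part of [x], itself a sum of squared moduli including that of [f x]. *)
Lemma purity_gt0 A f x : f x != 0 -> 0 < purity A f.
Proof.
move=> fx; rewrite lt_def purity_ge0 andbT; apply/negP => /eqP.
have ge0 a a' : 0 <= rdm A f a a' * rdm A f a' a.
  by rewrite (rdm_conj _ _ a a') mul_conjC_ge0.
move=> /psumr_eq0P /= => /(_ (fun a _ => sumr_ge0 _ (fun a' _ => ge0 a a'))).
move=> /(_ (restr A x) isT) /psumr_eq0P => /(_ (fun a' _ => ge0 _ a')).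
move=> /(_ (restr A x) isT) /eqP; rewrite mulf_eq0 orbb /rdm => /eqP.
move=> /psumr_eq0P => /(_ (fun b _ => mul_conjC_ge0 _)).
move=> /(_ (restr (~: A) x) isT) /eqP; rewrite bipartE mul_conjC_eq0.
by apply/negP.
Qed.

End Bipartite.

(** * Rearranging subsets of a line by unit moves *)

Section Moves.
Context {L : nat} {V : Type}.
Implicit Types (S : {set 'I_L}).

(* Moving elements down as long as possible packs a set into an initial segment. *)
Lemma move_invariant (f : {set 'I_L} -> V) :
    (forall (j j' : 'I_L) S, val j' = j.+1 -> j \in S -> j' \notin S ->
       f (j' |: (S :\ j)) = f S) ->
  forall S1 S2, #|S1| = #|S2| -> f S1 = f S2.
Proof.
move=> fP; suff packed S : f S = f [set j : 'I_L | (j < #|S|)%N].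
  by move=> S1 S2 e; rewrite packed e -packed.
(* Induction on the sum of the positions, which each downward move (the hypothesis read backwards)
   lowers by one. *)
have [m] := ubnP (\sum_(j in S) (j : nat))%N; elim: m S => // m IH S ltm.
case: (boolP [exists j : 'I_L, [exists j' : 'I_L,
    [&& val j' == j.+1, j' \in S & j \notin S]]]).
  move=> /existsP [j /existsP [j' /and3P [/eqP e j'S jS]]].
  have jS0 : j' \notin j |: (S :\ j').
    by rewrite !inE eqxx orbF /= -val_eqE /= e eqn_leq ltnn.
  have jD : j \notin S :\ j' by rewrite !inE (negbTE jS) andbF.
  have eS : j' |: ((j |: (S :\ j')) :\ j) = S.
    by rewrite setU1K // setD1K.
  rewrite -{1}eS (fP j) // ?setU11 // IH; last first.
    rewrite big_setU1 //= -ltnS (leq_trans _ ltm) // ltnS.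
    by rewrite (big_setD1 j' j'S) /= e addSn.
  by rewrite cardsU1 jD (cardsD1 j' S) j'S.
(* With no downward move left, the set is closed downwards, hence an initial segment. *)
move=> /existsPn stuck; congr f.
have down (j j' : 'I_L) : j' \in S -> (j <= j')%N -> j \in S.
  have [d] := ubnP (j' - j)%N; elim: d j j' => // d IHd j j' ltd j'S.
  rewrite leq_eqVlt => /orP [/eqP/val_inj -> //|lt].
  have j'0 : (0 < j')%N by apply: leq_ltn_trans lt.
  have lt' : (j'.-1 < L)%N by apply: leq_ltn_trans (leq_pred _) (ltn_ord _).
  apply: (IHd j (Ordinal lt')) => /=; last by rewrite -ltnS prednK.
    by rewrite -ltnS (leq_trans _ ltd) // ltnS -subn1 subnAC subn1 prednK // subn_gt0.
  have := stuck (Ordinal lt') => /existsPn /(_ j').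
  by rewrite /= prednK // eqxx j'S /= negbK.
apply/setP => j; rewrite inE; apply/idP/idP => jS.
  have sub : [set i : 'I_L | (i < j.+1)%N] \subset S.
    by apply/fintype.subsetP => i; rewrite inE ltnS; apply: down.
  apply: leq_trans (subset_leq_card sub).
  by rewrite cardsE -sum1_card (big_ord_narrow (ltn_ord j)) sum1_card card_ord.
apply: contraTT jS => jS; rewrite -leqNgt.
have sub : S \subset [set i : 'I_L | (i < j)%N].
  apply/fintype.subsetP => i iS; rewrite inE ltnNge; apply: contra jS => ji.
  exact: down iS ji.
apply: leq_trans (subset_leq_card sub) _.
by rewrite cardsE -sum1_card (big_ord_narrow (ltnW (ltn_ord j))) sum1_card card_ord.
Qed.

End Moves.

(** * Local operators and their action on the swap form *)

Section Locality.
Context {R : realType} {n : nat}.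
Local Notation C := R[i].
Implicit Types (A J : {set 'I_n}) (x y z w : qconf n) (f g h k v : qconf n -> C)
  (M N : qop R n).

Definition agree_off J x y := [forall l, (l \notin J) ==> (x l == y l)].

(** Entrywise form of an operator on the qubits of [J] tensored with the identity: coordinates
    outside [J] are neither changed nor read. *)
Definition local J M :=
  (forall x y, ~~ agree_off J x y -> M x y = 0) /\
  (forall x y x' y', agree_off J x y -> agree_off J x' y' ->
     {in J, x =1 x'} -> {in J, y =1 y'} -> M x y = M x' y').

Lemma agree_offP J x y :
  reflect (forall l, l \notin J -> x l = y l) (agree_off J x y).
Proof.
apply: (iffP forallP) => [H l lJ|H l]; first by move: (H l); rewrite lJ => /eqP.
by apply/implyP => lJ; rewrite H.
Qed.

Lemma agree_offC J x y : agree_off J x y = agree_off J y x.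
Proof. by apply: eq_forallb => l; rewrite eq_sym. Qed.

Lemma local_sub J J' M : J \subset J' -> local J M -> local J' M.
Proof.
move=> /fintype.subsetP sJ [M0 ME]; have sub x y : agree_off J x y -> agree_off J' x y.
  by move=> /agree_offP e; apply/agree_offP => l lJ; apply: e; apply: contra lJ => /sJ.
split => [x y /(contra (sub _ _)) /M0 //|x y x' y' e e' ex ey].
have E : agree_off J x y = agree_off J x' y'.
  apply/agree_offP/agree_offP => H l lJ; case: (boolP (l \in J')) => lJ'.
  - by rewrite -ex // -ey // H.
  - exact: (agree_offP _ _ _ e').
  - by rewrite ex // ey // H.
  - exact: (agree_offP _ _ _ e).
case: (boolP (agree_off J x y)) => a; last by rewrite !M0 // -E.
by apply: ME; rewrite -?E // => l /sJ; [apply: ex|apply: ey].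
Qed.

Lemma local_scale J (a : C) : local J (scaleop a (idop R n)).
Proof.
split => [x y|x y x' y' /agree_offP e /agree_offP e' ex ey]; rewrite /scaleop /idop.
  case: eqP => [->|_ _]; last by rewrite mulr0.
  by move=> /negP[]; apply/agree_offP.
congr (_ * (_ : bool)%:R); apply/eqP/eqP => /ffunP H; apply/ffunP => l.
  case: (boolP (l \in J)) => lJ; last exact: e'.
  by rewrite -ex // -ey.
case: (boolP (l \in J)) => lJ; last exact: e.
by rewrite ex // ey.
Qed.

Lemma acts_on2_local M (i j : 'I_n) : acts_on2 M i j -> local [set i; j] M.
Proof.
move=> [v ME].
have E x y : [forall l, (l != i) && (l != j) ==> (x l == y l)] = agree_off [set i; j] x y.
  by apply: eq_forallb => l; rewrite !inE negb_or.
split => [x y ne|x y x' y' e e' ex ey]; rewrite !ME !E; first by rewrite (negbTE ne) mulr0.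
by rewrite e e' (ex i) ?(ex j) ?(ey i) ?(ey j) // !inE eqxx ?orbT.
Qed.

(** A single intermediate configuration survives: it already equals [z] on [J] and still equals [x]
    elsewhere. *)
Lemma mulop_local J J' M N x z : [disjoint J & J'] -> local J M -> local J' N ->
  mulop M N x z = M x (mix J z x) * N (mix J z x) z.
Proof.
move=> dJ [M0 _] [N0 _]; rewrite /mulop (bigD1 (mix J z x)) //= big1 ?addr0 // => y ne.
case: (boolP (agree_off J x y)) => [/agree_offP e|/M0 ->]; last by rewrite mul0r.
case: (boolP (agree_off J' y z)) => [/agree_offP e'|/N0 ->]; last by rewrite mulr0.
case/eqP: ne; apply/ffunP => l; rewrite ffunE.
case: (boolP (l \in J)) => lJ; last by rewrite e.
by rewrite e' // (disjointFr dJ).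
Qed.

Lemma local_comm J J' M N : [disjoint J & J'] -> local J M -> local J' N ->
  mulop M N = mulop N M.
Proof.
move=> dJ lM lN; apply/funext => x; apply/funext => z.
rewrite (mulop_local _ _ _ _ _ _ dJ lM lN).
rewrite disjoint_sym in dJ; rewrite (mulop_local _ _ _ _ _ _ dJ lN lM) [RHS]mulrC.
case: lM lN => M0 ME [N0 NE].
have nJ l : l \in J -> l \notin J'.
  by move=> lJ; rewrite (disjointFl dJ lJ).
have a1 : agree_off J x (mix J z x).
  by apply/agree_offP => l lJ; rewrite ffunE (negbTE lJ).
have a2 : agree_off J' x (mix J' z x).
  by apply/agree_offP => l lJ; rewrite ffunE (negbTE lJ).
(* Both sides say that [x] and [z] agree outside the union of [J] and [J']. *)
have E : agree_off J (mix J' z x) z = agree_off J' (mix J z x) z.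
  apply/agree_offP/agree_offP => H l lJ; rewrite ffunE.
    case: ifP => // /negbT lJ'; move: (H l lJ'); by rewrite ffunE (negbTE lJ).
  case: ifP => // /negbT lJ'; move: (H l lJ'); by rewrite ffunE (negbTE lJ).
case: (boolP (agree_off J (mix J' z x) z)) => a; last first.
  by rewrite (M0 _ _ a) N0 -?E // mul0r mulr0.
congr (_ * _).
  apply: ME => // l lJ; rewrite ffunE ?lJ //.
  by rewrite (negbTE (nJ _ lJ)).
have nJ' l : l \in J' -> (l \in J) = false by exact: disjointFr.
by apply: NE; rewrite -?E // => l lJ; rewrite ffunE ?lJ ?nJ'.
Qed.

Lemma applyop_mul M N v : applyop (mulop M N) v = applyop M (applyop N v).
Proof.
apply/funext => x; rewrite /applyop /mulop.
under eq_bigr do rewrite mulr_suml.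
rewrite exchange_big; apply: eq_bigr => y _; rewrite mulr_sumr.
by apply: eq_bigr => z _; rewrite mulrA.
Qed.

Lemma applyop_scale (a : C) v : applyop (scaleop a (idop R n)) v = fun x => a * v x.
Proof.
apply/funext => x; rewrite /applyop /scaleop /idop (bigD1 x) //= eqxx mulr1 big1 ?addr0 //.
by move=> y /negbTE ne; rewrite eq_sym ne mulr0 mul0r.
Qed.

Lemma applyop_id v : applyop (idop R n) v = v.
Proof.
rewrite -[RHS](_ : (fun x => 1 * v x) = v); last by apply/funext => x; rewrite mul1r.
by rewrite -applyop_scale; congr (applyop _ v); do 2 apply/funext => ?; rewrite /scaleop mul1r.
Qed.

Lemma applyopZ M (a : C) v : applyop M (fun x => a * v x) = fun x => a * applyop M v x.
Proof.
apply/funext => x; rewrite /applyop mulr_sumr.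
by apply: eq_bigr => y _; rewrite mulrCA.
Qed.

Lemma unitary_scale (a : C) : `|a| = 1 -> unitary (scaleop a (idop R n)).
Proof.
move=> na; have aa : a * a^* = 1 by rewrite -normCK na expr1n.
split; apply/funext => x; apply/funext => y; rewrite /mulop /adjop /scaleop /idop;
  rewrite (bigD1 x) //= big1 ?addr0 => [|z /negbTE ne].
- by rewrite eqxx mulr1 mulrA [_^* * _]mulrC aa mul1r.
- by rewrite ne mulr0 rmorph0 mul0r.
- rewrite eqxx mulr1 rmorphM rmorph_nat mulrA aa mul1r eq_sym //.
- by rewrite eq_sym ne mulr0 mul0r.
Qed.

Lemma applyop_neq0 M v x :
  unitary M -> v x != 0 -> exists y, applyop M v y != 0.
Proof.
move=> [uM _] vx; apply/not_existsP => H.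
have : applyop (adjop M) (applyop M v) x = 0.
  by rewrite /applyop big1 // => y _; rewrite -/(applyop M v y); move: (H y) => /negP/negPn/eqP ->; rewrite mulr0.
by rewrite -applyop_mul uM applyop_id => /eqP; rewrite (negbTE vx).
Qed.

(** The states [h] and [g] share their summed [A]-index, that of [y], one of them conjugated; there
    [M] meets its adjoint and cancels. *)
Lemma swap_form_local A M f g h k : unitary M -> local A M ->
  swap_form A f (applyop M g) (applyop M h) k = swap_form A f g h k.
Proof.
move=> [uM _] [M0 ME]; rewrite /swap_form; apply: eq_bigr => x _.
transitivity (\sum_y \sum_z \sum_w f x * (k (mix A x y))^* * h z * (g w)^* *
    (M y z * (M (mix A y x) w)^*)).
  apply: eq_bigr => y _; rewrite /applyop rmorph_sum mulr_sumr mulr_suml mulr_suml.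
  apply: eq_bigr => z _; rewrite mulr_sumr mulr_suml; apply: eq_bigr => w _.
  rewrite rmorphM /=; ring.
rewrite exchange_big /=; apply: eq_bigr => z _; rewrite exchange_big /=.
transitivity (\sum_w f x * (k (mix A x z))^* * h z * (g w)^* *
   (agree_off A w x && (mix A w z == z))%:R).
  apply: eq_bigr => w _.
  (* Locality moves the second entry of [M] from the background of [x] to that of [z], so the sum
     over [y] becomes an entry of [adjop M] times [M]. *)
  transitivity (\sum_y f x * (k (mix A x z))^* * h z * (g w)^* *
     ((agree_off A w x)%:R * ((M y (mix A w z))^* * M y z))).
    apply: eq_bigr => y _; case: (boolP (agree_off A y z)) => [ayz|/M0 ->]; last first.
      by rewrite !(mulr0, mul0r).
    congr (_ * _).
      congr (_ * _ * _ * _); congr ((k _)^*); apply/ffunP => l; rewrite !ffunE.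
      by case: ifP => // /negbT; apply: (agree_offP _ _ _ ayz).
    rewrite mulrC; have E : agree_off A (mix A y x) w = agree_off A w x.
      rewrite agree_offC; apply/agree_offP/agree_offP => H l lA; rewrite H //.
        by rewrite ffunE (negbTE lA).
      by rewrite ffunE (negbTE lA).
    case: (boolP (agree_off A w x)) => a; last first.
      by rewrite (M0 (mix A y x) w) ?E // rmorph0 !mul0r.
    rewrite mul1r; congr (_^* * _); apply: ME; rewrite ?E //.
    - apply/agree_offP => l lA; rewrite ffunE (negbTE lA).
      exact: (agree_offP _ _ _ ayz).
    - by move=> l lA; rewrite ffunE lA.
    - by move=> l lA; rewrite ffunE lA.
  rewrite -mulr_sumr -mulr_sumr; congr (_ * _).
  move/(congr1 (fun N => N (mix A w z) z)): uM; rewrite /mulop /adjop /idop => ->.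
  by rewrite -natrM mulnb.
(* The two constraints on [w], equal to [x] off [A] and to [z] on [A], leave one term. *)
rewrite (bigD1 (mix A z x)) //= big1 ?addr0 => [|w ne].
  have -> : agree_off A (mix A z x) x.
    by apply/agree_offP => l lA; rewrite ffunE (negbTE lA).
  have -> : mix A (mix A z x) z == z.
    by apply/eqP/ffunP => l; rewrite !ffunE; case: (l \in A).
  by rewrite mulr1; ring.
case: (boolP (_ && _)); last by rewrite mulr0.
move=> /andP [/agree_offP e /eqP/ffunP e2]; case/eqP: ne; apply/ffunP => l.
rewrite ffunE; case: ifP => [lA|/negbT lA]; last by rewrite e.
by move: (e2 l); rewrite ffunE lA.
Qed.

End Locality.

(** * Fermion operators and plane-wave states in the Jordan-Wigner encoding *)

Section Fermions.
Context {R : realType} {n : nat}.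
Local Notation C := R[i].
Implicit Types (o : fconf n) (s t m : 'I_n) (v w : fstate R n) (S : {set 'I_n}).

Definition occupation S : fconf n := [ffun i => i \in S].
Definition supp o : {set 'I_n} := [set i | o i].

Lemma occupationK : cancel occupation supp.
Proof. by move=> S; apply/setP => i; rewrite inE ffunE. Qed.

Lemma suppK : cancel supp occupation.
Proof. by move=> o; apply/ffunP => i; rewrite ffunE inE. Qed.

Lemma enum_sorted S : sorted (fun s t : 'I_n => (s < t)%N) (enum S).
Proof.
rewrite /enum_mem; apply: sorted_filter => [x y z|]; first exact: ltn_trans.
by have := iota_ltn_sorted 0 n; rewrite -val_enum_ord sorted_map enumT.
Qed.

Definition upd o t (b : bool) : fconf n := [ffun s => if s == t then b else o s].

Lemma upd_at o t b : upd o t b t = b.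
Proof. by rewrite ffunE eqxx. Qed.

Lemma upd_neq o s t b : s != t -> upd o t b s = o s.
Proof. by rewrite ffunE => /negbTE ->. Qed.

Lemma upd_upd o t b b' : upd (upd o t b) t b' = upd o t b'.
Proof. by apply/ffunP => s; rewrite !ffunE; case: eqP. Qed.

Lemma upd_id o t : upd o t (o t) = o.
Proof. by apply/ffunP => s; rewrite ffunE; case: eqP => [->|]. Qed.

Lemma upd_comm o s t b b' : s != t -> upd (upd o s b) t b' = upd (upd o t b') s b.
Proof.
move=> st; apply/ffunP => r; rewrite !ffunE.
by case: eqP => // ->; rewrite eq_sym (negbTE st).
Qed.

Definition jw_sign t o : C := (-1) ^+ #|[set s : 'I_n | o s & (s < t)%N]|.

(** The annihilation operator, adjoint to [cdag]; it serves to show that the fermion state is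
    nonzero. *)
Definition cann t v : fstate R n := fun o =>
  if o t then 0 else jw_sign t o * v (upd o t true).

Lemma cdagE t v o : cdag t v o = if o t then jw_sign t o * v (upd o t false) else 0.
Proof. by []. Qed.

Lemma jw_sign_sq t o : jw_sign t o * jw_sign t o = 1.
Proof. by rewrite /jw_sign -expr2 sqrr_sign. Qed.

Lemma jw_sign_upd t s o :
  jw_sign t (upd o s true) = (-1) ^+ (s < t)%N * jw_sign t (upd o s false).
Proof.
rewrite /jw_sign -exprD; congr (_ ^+ _).
rewrite (cardsD1 s) inE upd_at /=; congr (_ + #|pred_of_set _|)%N.
by apply/setP => r; rewrite !inE !ffunE; case: (r == s).
Qed.

Lemma jw_sign_at t o b : jw_sign t (upd o t b) = jw_sign t o.
Proof.
have E b' : jw_sign t (upd o t b') = jw_sign t (upd o t true).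
  by case: b' => //; rewrite jw_sign_upd ltnn mul1r.
by rewrite -{2}(upd_id o t) !E.
Qed.

(** For [s = t] exactly one term survives, depending on [o t]. For distinct sites both survive or
    none, and the signs are opposite because exactly one of [s < t] and [t < s] holds. *)
Lemma anticommutator s t v o :
  cann s (cdag t v) o + cdag t (cann s v) o = (s == t)%:R * v o.
Proof.
rewrite cdagE /cann; case: (eqVneq s t) => [->|st].
  rewrite mul1r !cdagE !upd_at !upd_upd.
  by case E : (o t); rewrite ?add0r ?addr0 mulrA jw_sign_at jw_sign_sq mul1r -E upd_id.
rewrite mul0r cdagE !upd_neq //; last by rewrite eq_sym.
case Es : (o s); case Et : (o t); rewrite ?mulr0 ?addr0 //.
rewrite upd_comm // !mulrA -mulrDl.
have -> : jw_sign s o = (-1) ^+ (t < s)%N * jw_sign s (upd o t false).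
  by rewrite -jw_sign_upd -Et upd_id.
have -> : jw_sign t (upd o s true) = (-1) ^+ (s < t)%N * jw_sign t o.
  by rewrite jw_sign_upd -Es upd_id.
suff -> : (-1) ^+ (s < t)%N = - (-1) ^+ (t < s)%N :> C.
  have : (-1) ^+ (t < s)%N * (-1) ^+ (t < s)%N = 1 :> C by rewrite -expr2 sqrr_sign.
  move: ((-1) ^+ _) => e ee; rewrite mulrACA mulrN ee mulN1r (mulrC (jw_sign t o)) addNr mul0r //.
by case: (ltngtP s t) st => [||/val_inj ->]; rewrite ?eqxx // opprK.
Qed.

Lemma cann_sum s (a : C) (e : 'I_n -> C) (w : 'I_n -> fstate R n) o :
  cann s (fun o' => a * \sum_t e t * w t o') o = a * \sum_t e t * cann s (w t) o.
Proof.
rewrite /cann; case: (o s); first by under eq_bigr do rewrite mulr0; rewrite big1 ?mulr0.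
by rewrite mulrCA; congr (_ * _); rewrite mulr_sumr; apply: eq_bigr => t _; rewrite mulrCA.
Qed.

Lemma cdag_sum s (a : C) (e : 'I_n -> C) (w : 'I_n -> fstate R n) o :
  cdag s (fun o' => a * \sum_t e t * w t o') o = a * \sum_t e t * cdag s (w t) o.
Proof.
rewrite cdagE; under [in RHS]eq_bigr do rewrite cdagE.
case: (o s); last by rewrite big1 ?mulr0 // => t _; rewrite mulr0.
by rewrite mulrCA; congr (_ * _); rewrite mulr_sumr; apply: eq_bigr => t _; rewrite mulrCA.
Qed.

Lemma expiD (x y : R) : expi (x + y) = expi x * expi y :> C.
Proof.
rewrite /expi cosD sinD; apply/eqP; rewrite eq_complex /= eqxx /=.
by rewrite addrC (mulrC (cos x)) (mulrC (sin x)) mulrC (mulrC (cos y)) eqxx.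
Qed.

Lemma expi0 : expi 0 = 1 :> C.
Proof. by rewrite /expi cos0 sin0. Qed.

Lemma expi_conj (x : R) : (expi x)^* = expi (- x) :> C.
Proof. by rewrite /expi cosN sinN. Qed.

Lemma expiMn (x : R) k : expi (x * k%:R) = expi x ^+ k :> C.
Proof.
elim: k => [|k IH]; first by rewrite mulr0 expi0.
by rewrite exprS -IH -expiD -natr1 mulrDr mulr1 addrC.
Qed.

Lemma expi2pi : expi (2 * pi) = 1 :> C.
Proof. by rewrite /expi mulr_natl cos2pi sin2pi. Qed.

Lemma norm_expi (x : R) : `|expi x| = 1 :> C.
Proof.
apply/eqP; rewrite -(@pexpr_eq1 _ _ 2) // normCK expi_conj -expiD subrr expi0 //.
Qed.

(** By the half-angle formula a cosine equal to 1 would force [sin (x / 2) = 0], while [x / 2] lies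
    strictly between 0 and [pi]. *)
Lemma expi_neq1 (x : R) : 0 < x < 2 * pi -> expi x != 1 :> C.
Proof.
move=> /andP [x0 x1]; rewrite eq_complex /= negb_and; apply/orP; left.
apply/eqP; have -> : x = (x / 2) *+ 2 by rewrite -mulr_natr divfK // pnatr_eq0.
rewrite cos_mulr2n => c1.
have : 0 < sin (x / 2) by apply: sin_gt0_pi; apply/andP; split; lra.
have := sin2cos2 (x / 2); move: c1; rewrite -mulr_natr /= => c1 s1 s0; nra.
Qed.

Lemma expi_root_neq1 m m' : (m < m')%N -> expi (2 * pi * (m'%:R - m%:R) / n%:R) != 1 :> C.
Proof.
move=> lt; have n0 : (0 : R) < n%:R by rewrite ltr0n (leq_ltn_trans _ (ltn_ord m)).
have d0 : (0 : R) < m'%:R - m%:R by rewrite subr_gt0 ltr_nat.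
have dn : (m'%:R - m%:R : R) < n%:R.
  by rewrite ltrBlDr (lt_le_trans (y := n%:R)) ?ltr_nat // lerDl.
have p0 : (0 : R) < 2 * pi by rewrite mulr_gt0 // pi_gt0.
apply: expi_neq1; rewrite divr_gt0 //=; last exact: mulr_gt0.
by rewrite ltr_pdivrMr // ltr_pM2l.
Qed.

(** The twist [phi / n] cancels, leaving a geometric sum over the powers of an [n]-th root of unity,
    which differs from 1 for distinct momenta. *)
Lemma fourier_orthogonality (phi : R) m m' :
  \sum_(t < n) (expi ((2 * pi * m%:R / n%:R - phi / n%:R) * t%:R))^* *
     expi ((2 * pi * m'%:R / n%:R - phi / n%:R) * t%:R) = n%:R * (m == m')%:R :> C.
Proof.
have n0 : (n%:R : R) != 0 by rewrite pnatr_eq0 -lt0n (leq_ltn_trans _ (ltn_ord m)).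
pose z : C := expi (2 * pi * (m'%:R - m%:R) / n%:R).
transitivity (\sum_(t < n) z ^+ t).
  apply: eq_bigr => t _; rewrite expi_conj -expiD -expiMn; congr expi; ring.
case: (eqVneq m m') => [e|ne].
  rewrite mulr1 /z e subrr mulr0 mul0r expi0; under eq_bigr do rewrite expr1n.
  by rewrite sumr_const card_ord.
rewrite mulr0; have zn : z ^+ n = 1.
  by rewrite -expiMn divfK // mulrBr expiD -expi_conj !expiMn expi2pi !expr1n rmorph1 mulr1.
have z1 : z != 1.
  case: (ltngtP m m') => [lt|lt|/val_inj/eqP]; last by rewrite (negbTE ne).
    exact: expi_root_neq1.
  have -> : z = (expi (2 * pi * (m%:R - m'%:R) / n%:R))^*.
    by rewrite expi_conj /z; congr expi; ring.
  by rewrite (fmorph_eq1 Num.conj) expi_root_neq1.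
apply/eqP; move: (subrX1 z n); rewrite zn subrr => /esym/eqP.
by rewrite mulf_eq0 subr_eq0 (negbTE z1).
Qed.

(** Each new mode is created below all occupied ones, so every Jordan-Wigner sign is trivial. *)
Lemma foldr_cdag_vac (s : seq 'I_n) : sorted (fun s t : 'I_n => (s < t)%N) s ->
  foldr (fun t v => cdag t v) (vac n) s = (fun o => (o == [ffun i => i \in s])%:R : C).
Proof.
elim: s => [_|t s IH] /=.
  by apply/funext => o; rewrite /vac; congr (_ == _)%:R; apply/ffunP => i; rewrite !ffunE.
have tr : transitive (fun s t : 'I_n => (s < t)%N) by move=> ? ? ?; apply: ltn_trans.
rewrite (path_sortedE tr) => /andP [/allP ts /IH IHs]; rewrite IHs; apply/funext => o; rewrite cdagE.
have nts : t \notin s by apply/negP => /ts; rewrite ltnn.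
case: (eqVneq o [ffun i => i \in t :: s]) => [->|ne].
  rewrite ffunE mem_head.
  have -> : upd [ffun i => i \in t :: s] t false = [ffun i => i \in s].
    apply/ffunP => i; rewrite !ffunE inE; case: (eqVneq i t) => [->|//].
    by rewrite (negbTE nts).
  rewrite eqxx mulr1 /jw_sign (_ : [set _ | _] = set0) ?cards0 //.
  apply/setP => r; rewrite !inE ffunE inE; case: (eqVneq r t) => [->|_] /=.
    by rewrite ltnn.
  by apply/negP => /andP [/ts lt]; rewrite ltnNge (ltnW lt).
case E : (o t) => //; case: eqP => [e|]; last by rewrite mulr0.
case/eqP: ne; rewrite -(upd_id o t) E -(upd_upd _ _ false) e.
by apply/ffunP => i; rewrite !ffunE inE; case: eqP.
Qed.

Lemma ctup_vacE S : ctup_vac S = (fun o => (o == occupation S)%:R : C).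
Proof.
rewrite /ctup_vac foldr_cdag_vac ?enum_sorted //; apply/funext => o.
by congr (_ == _)%:R; apply/ffunP => i; rewrite !ffunE mem_enum.
Qed.

(** Every mode operator adds one particle. This conservation law restricts the terms of the purity
    expansion. *)
Lemma ckphi_vac_card (phi : R) (ks : seq 'I_n) o :
  ckphi_vac phi ks o != 0 -> #|supp o| = size ks.
Proof.
elim: ks o => [|m ks IH] o /=.
  rewrite /vac; case: (eqVneq o [ffun=> false]) => [-> _|_]; last by rewrite eqxx.
  by apply/eqP; rewrite cards_eq0; apply/eqP/setP => i; rewrite !inE ffunE.
rewrite /bdag mulf_eq0 negb_or => /andP [_].
move=> /negP H; have [t] : exists t, cdag t (ckphi_vac phi ks) o != 0.
  apply/not_existsP => H0; apply: H; apply/eqP; rewrite big1 // => t _.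
  by move: (H0 t) => /negP/negPn/eqP ->; rewrite mulr0.
rewrite cdagE; case E : (o t); last by rewrite eqxx.
rewrite mulf_eq0 negb_or => /andP [_ /IH <-].
rewrite (cardsD1 t) inE E; congr (_ + #|pred_of_set _|)%N.
by apply/setP => r; rewrite !inE ffunE; case: (r == t).
Qed.

Lemma varphiE (phi : R) (ks : seq 'I_n) S :
  varphi phi ks S = ckphi_vac phi ks (occupation S).
Proof.
rewrite /varphi /finner ctup_vacE (bigD1 (occupation S)) //= eqxx rmorph1 mul1r.
by rewrite big1 ?addr0 // => o /negbTE ->; rewrite rmorph0 mul0r.
Qed.

Definition bann (phi : R) m v : fstate R n := fun o =>
  ((Num.sqrt (n%:R : R))^-1)%:C%C *
  \sum_(t : 'I_n) (expi ((2 * pi * m%:R / n%:R - phi / n%:R) * t%:R))^* * cann t v o.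

(** Bilinearity reduces to the site relations; the remaining sum over sites is the Fourier
    orthogonality relation, normalised by the two factors of [1 / sqrt n]. *)
Lemma mode_anticommutator (phi : R) m m' v o :
  bann phi m (bdag phi m' v) o + bdag phi m' (bann phi m v) o = (m == m')%:R * v o.
Proof.
have n0 : (0 < n)%N by rewrite (leq_ltn_trans _ (ltn_ord m)).
rewrite /bann /bdag; under eq_bigr do rewrite cann_sum mulrCA mulr_sumr.
under [X in _ + _ * X]eq_bigr do rewrite cdag_sum mulrCA mulr_sumr.
rewrite -!mulr_sumr [X in _ + _ * (_ * X)]exchange_big -!mulrDr -big_split /=.
set a := (_%:C)%C.
rewrite (eq_bigr (fun s : 'I_n => v o * ((expi ((2 * pi * m%:R / n%:R - phi / n%:R) * s%:R))^* *
     expi ((2 * pi * m'%:R / n%:R - phi / n%:R) * s%:R)))) => [|s _]; last first.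
  rewrite -big_split /= (bigD1 s) //= [X in _ + X]big1 ?addr0 => [|t ts].
    have := anticommutator s s v o; rewrite eqxx mul1r => {1}<-; ring.
  have := anticommutator s t v o; rewrite eq_sym (negbTE ts) mul0r => ac.
  rewrite mulrCA -mulrDr -mulrDr ac; ring.
rewrite -mulr_sumr fourier_orthogonality.
have aa : a * a * n%:R = 1.
  rewrite /a -rmorphM /= -invfM -expr2 sqr_sqrtr ?ler0n //.
  have -> : n%:R = (n%:R : R)%:C%C :> C by rewrite rmorph_nat.
  rewrite -rmorphM /= mulVf ?rmorph1 //.
  by rewrite pnatr_eq0 -lt0n.
transitivity (a * a * n%:R * ((m == m')%:R * v o)); last by rewrite aa mul1r.
by move: (_%:R) (n%:R) => b c; ring.
Qed.

Lemma bann0 (phi : R) m o : bann phi m (fun=> 0) o = 0.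
Proof.
rewrite /bann big1 ?mulr0 // => t _.
by rewrite /cann mulr0 if_same mulr0.
Qed.

Lemma bdag0 (phi : R) m o : bdag phi m (fun=> 0) o = 0.
Proof.
by rewrite /bdag big1 ?mulr0 // => t _; rewrite cdagE mulr0 if_same mulr0.
Qed.

(** The annihilator anticommutes past each mode of different momentum until it reaches the
    vacuum. *)
Lemma bann_ckphi_vac (phi : R) m (ks : seq 'I_n) :
  m \notin ks -> bann phi m (ckphi_vac phi ks) = fun=> 0.
Proof.
elim: ks => [_|k ks IH] /=.
  apply/funext => o.
  rewrite /bann big1 ?mulr0 // => t _; rewrite /cann /vac; case: ifP => _; rewrite ?mulr0 //.
  case: eqP => [/ffunP/(_ t)|]; last by rewrite !mulr0.
  by rewrite upd_at ffunE.
rewrite inE negb_or => /andP [mk /IH mks]; apply/funext => o.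
have := mode_anticommutator phi m k (ckphi_vac phi ks) o.
by rewrite (negbTE mk) mul0r mks bdag0 addr0.
Qed.

(** If creating the new mode gave 0, both terms of its anticommutator would vanish on the previous
    state, which would then be 0. *)
Lemma ckphi_vac_neq0 (phi : R) (ks : seq 'I_n) :
  uniq ks -> exists o, ckphi_vac phi ks o != 0.
Proof.
elim: ks => [_|m ks IH] /=; first by exists [ffun=> false]; rewrite /vac eqxx oner_neq0.
move=> /andP [mks /IH [x wx]]; apply/not_existsP => H.
have H0 : bdag phi m (ckphi_vac phi ks) = fun=> 0.
  by apply/funext => o'; move: (H o') => /negP/negPn/eqP.
have := mode_anticommutator phi m m (ckphi_vac phi ks) x.
rewrite eqxx mul1r H0 bann0 bann_ckphi_vac // bdag0 addr0 => e.
by rewrite -e eqxx in wx.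
Qed.

End Fermions.

(** * Cyclic intervals: offsets, complements and moves *)

Section CyclicIntervals.
Context {n : nat}.
Implicit Types (S J : {set 'I_n}) (t : 'I_n).

Lemma offset_inj i j j' : (j < n)%N -> (j' < n)%N -> (i + j = i + j' %[mod n])%N -> j = j'.
Proof. by move=> lj lj' /eqP; rewrite eqn_modDl !modn_small // => /eqP. Qed.

Lemma offset_exists i t : exists2 j : 'I_n, (j < n)%N & val t = ((i + j) %% n)%N.
Proof.
have n0 : (0 < n)%N by rewrite (leq_ltn_trans _ (ltn_ord t)).
have lt : ((t + (n - i %% n)) %% n < n)%N by rewrite ltn_pmod.
exists (Ordinal lt) => //=; rewrite modnDmr.
have -> : (i + (t + (n - i %% n)))%N = ((i %/ n).+1 * n + t)%N.
  rewrite {1}(divn_eq i n) -addnA (addnCA (i %% n)%N) subnKC ?(ltnW (ltn_pmod _ _)) //.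
  by rewrite mulSnr -addnA (addnC n).
by rewrite modnMDl modn_small.
Qed.

Lemma mem_cyc_interval i l t (j : 'I_n) :
  val t = ((i + j) %% n)%N -> (t \in cyc_interval n i l) = (j < l)%N.
Proof.
move=> e; rewrite inE; apply/existsP/idP => [[j' /andP [lt /eqP e']]|lt].
  by rewrite (offset_inj i j j') // -e -e'.
by exists j; rewrite lt -e eqxx.
Qed.

(** For [l >= n] the truncated length [n - l] is 0, matching the empty complement. *)
Lemma cyc_intervalC i l : ~: cyc_interval n i l = cyc_interval n (i + l) (n - l).
Proof.
apply/setP => t; have [j lj e] := offset_exists i t.
rewrite inE (mem_cyc_interval _ _ _ _ e) -leqNgt inE.
apply/idP/existsP => [lej|[j' /andP [lt' /eqP]]].
  have lt' : (j - l < n)%N by apply: leq_ltn_trans (leq_subr _ _) lj.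
  by exists (Ordinal lt'); rewrite /= ltn_sub2r ?(leq_ltn_trans lej) //= -addnA subnKC // e.
have lt : (l + j' < n)%N by rewrite -ltn_subRL.
rewrite e -addnA => ee; rewrite (offset_inj i j (l + j')) ?leq_addr //.
Qed.

(** Offsets unroll the interval into a segment, where [move_invariant] applies. *)
Lemma cyc_move_invariant {V : Type} i l (f : {set 'I_n} -> V) :
  let J := cyc_interval n i l in
    (forall (t t' : 'I_n) S, val t' = (t.+1 %% n)%N -> t \in J -> t' \in J ->
       S \subset J -> t \in S -> t' \notin S -> f (t' |: (S :\ t)) = f S) ->
  forall S1 S2, S1 \subset J -> S2 \subset J -> #|S1| = #|S2| -> f S1 = f S2.
Proof.
move=> J fP S1 S2 s1 s2.
case: (posnP n) => [n0 _|n0].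
  by congr f; apply/setP => -[t lt]; exfalso; rewrite n0 in lt.
(* The minimum keeps offsets distinct modulo [n] when [l] exceeds [n]. *)
pose L := minn l n.
pose p (j : 'I_L) : 'I_n := Ordinal (ltn_pmod (i + j) n0).
have jn (j : 'I_L) : (j < n)%N by apply: leq_trans (ltn_ord j) (geq_minr _ _).
have pI : injective p.
  by move=> j j' /(congr1 val) /= /offset_inj e; apply: val_inj; apply: e.
have pJ (j : 'I_L) : p j \in J.
  rewrite (mem_cyc_interval _ _ _ (Ordinal (jn j))) //=.
  by apply: leq_trans (ltn_ord j) (geq_minl _ _).
have onto S : S \subset J -> S = p @: (p @^-1: S).
  move=> /fintype.subsetP sJ; apply/setP => t; apply/idP/imsetP => [tS|[j]]; last first.
    by rewrite inE => ? ->.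
  have := sJ t tS; rewrite inE => /existsP [j /andP [lt /eqP e]].
  have lj : (j < L)%N by rewrite leq_min lt ltn_ord.
  have et : t = p (Ordinal lj) by apply: val_inj.
  by exists (Ordinal lj) => //; rewrite inE -et.
rewrite (onto _ s1) (onto _ s2) !card_imset //.
apply: (move_invariant (fun X => f (p @: X))) => j j' X e jX j'X.
have -> : p @: (j' |: (X :\ j)) = p j' |: ((p @: X) :\ p j).
  rewrite imsetU1; congr (_ |: _); apply/setP => t; rewrite !inE.
  apply/imsetP/andP => [[k]|[tj /imsetP [k kX ek]]].
    by rewrite !inE => /andP [kj kX] ->; rewrite (inj_eq pI) kj; split; rewrite ?imset_f.
  by exists k => //; rewrite !inE kX andbT; apply: contra tj => /eqP <-; rewrite ek.
apply: fP; rewrite ?mem_imset //=.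
- by rewrite e addnS -addn1 -modnDml addn1.
- by apply/fintype.subsetP => t /imsetP [k _ ->].
Qed.

End CyclicIntervals.

(** * Effect of moving a hand on the qubit state *)

Section Clock.
Context {R : realType} {n : nat}.
Local Notation C := R[i].
Context (u : nat -> qop R n) (c : C) (hc : `|c| = 1).
Context (hu : forall (t : nat) (ht : (t.+1 < n)%N),
  unitary (u t) /\ acts_on2 (u t) (Ordinal (ltnW ht)) (Ordinal ht)).
Context (hlast : u n.-1 = scaleop c (idop R n)).
Context (phi : R) (phivec : qconf n -> C).
Context (heig : applyop (Uto u n) phivec = (fun x => expi phi * phivec x)).
Implicit Types (S X Y Z : {set 'I_n}) (s t : 'I_n).

Definition hand_state S := applyop (Utup u S) phivec.

Lemma hand_stateE S :
  hand_state S = foldr (fun (t : 'I_n) w => applyop (Uto u t) w) phivec (enum S).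
Proof.
rewrite /hand_state /Utup; elim: (enum S) => /= [|t s IH]; first by rewrite applyop_id.
by rewrite applyop_mul IH.
Qed.

Lemma enum_unique S (s : seq 'I_n) :
  sorted (fun s t : 'I_n => (s < t)%N) s -> s =i S -> enum S = s.
Proof.
move=> ss e; apply: (irr_sorted_eq (leT := fun s t : 'I_n => (s < t)%N)) => //.
- by move=> ? ? ?; apply: ltn_trans.
- by move=> x; rewrite /= ltnn.
- exact: enum_sorted.
- by move=> x; rewrite mem_enum e.
Qed.

(** The gates in [Uto u s] touch only sites up to [s], below both sites of [u t]. *)
Lemma gate_comm (t s : nat) w : (t.+1 < n)%N -> (s < t)%N ->
  applyop (u t) (applyop (Uto u s) w) = applyop (Uto u s) (applyop (u t) w).
Proof.
move=> ht; elim: s => [|s IH] st /=; first by rewrite !applyop_id.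
have hs : (s.+1 < n)%N by apply: leq_trans (ltnW (ltnW ht)).
rewrite !applyop_mul -IH 1?ltnW // -[RHS]applyop_mul -[LHS]applyop_mul.
have /acts_on2_local lt := (hu t ht).2; have /acts_on2_local ls := (hu s hs).2.
rewrite (local_comm _ _ _ _ _ lt ls) //.
rewrite disjoint_subset; apply/fintype.subsetP => x; rewrite !inE.
by case/orP => /eqP ->; rewrite -!val_eqE /=; lia.
Qed.

Lemma gates_comm (t : nat) (L : seq 'I_n) w : (t.+1 < n)%N ->
  all (fun s : 'I_n => (s < t)%N) L ->
  applyop (u t) (foldr (fun (t : 'I_n) w => applyop (Uto u t) w) w L) =
  foldr (fun (t : 'I_n) w => applyop (Uto u t) w) (applyop (u t) w) L.
Proof. by move=> ht; elim: L => //= s L IH /andP [lt /IH <-]; rewrite gate_comm. Qed.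

Lemma enum_split S t : t \in S -> exists L Q : seq 'I_n,
  [/\ enum S = L ++ t :: Q, all (fun s : 'I_n => (s < t)%N) L
    & all (fun s : 'I_n => (t < s)%N) Q].
Proof.
have trans : transitive (fun s t : 'I_n => (s < t)%N) by move=> ? ? ?; apply: ltn_trans.
rewrite -mem_enum => tS; have := enum_sorted S; case/splitPr: tS => L Q.
rewrite (sorted_pairwise trans) pairwise_cat pairwise_cons allrel_consr.
by case/and3P => /andP [lL _] _ /andP [lQ _]; exists L, Q.
Qed.

(** The factor at [t] gains the gate [u t], which commutes to the far left past the factors of
    earlier hands. As [t'] was empty, replacing [t] keeps the enumeration increasing. *)
Lemma hand_state_hop (t t' : 'I_n) S : val t' = t.+1 -> t \in S -> t' \notin S ->
  hand_state (t' |: (S :\ t)) = applyop (u t) (hand_state S).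
Proof.
move=> e tS t'S; have [L [Q [eS lL lQ]]] := enum_split S t tS.
have ht : (t.+1 < n)%N by rewrite -e; exact: ltn_ord.
rewrite !hand_stateE eS foldr_cat /= gates_comm //.
have -> : enum (t' |: (S :\ t)) = L ++ t' :: Q.
  have eL x : x \in S = (x \in L ++ t :: Q) by rewrite -eS mem_enum.
  have trans : transitive (fun s t : 'I_n => (s < t)%N) by move=> ? ? ?; apply: ltn_trans.
  have lQ' : all (fun s : 'I_n => (t' < s)%N) Q.
    apply/allP => s sQ; rewrite ltn_neqAle e (allP lQ s sQ) andbT -e.
    apply: contra t'S => /eqP/val_inj ->.
    by rewrite eL mem_cat inE sQ !orbT.
  have lL' : all (fun s : 'I_n => (s < t')%N) L.
    by apply: sub_all lL => s /= lt; rewrite e ltnS ltnW.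
  apply: enum_unique => [|x].
    have := enum_sorted S; rewrite eS !(sorted_pairwise trans) !pairwise_cat.
    by rewrite !pairwise_cons !allrel_consr lL lL' lQ lQ'.
  rewrite !inE eL !mem_cat !inE.
  case: (eqVneq x t') => [//|xt']; rewrite ?orbT //=.
  case: (eqVneq x t) => [->|//] /=; apply/negbTE/negP.
  case/orP => [/(allP lL)|/(allP lQ)]; by rewrite ltnn.
by rewrite foldr_cat /= e /= applyop_mul.
Qed.

Lemma foldr_gates_scale (a : C) w (L : seq 'I_n) :
  foldr (fun (t : 'I_n) w => applyop (Uto u t) w) (fun x => a * w x) L =
  fun x => a * foldr (fun (t : 'I_n) w => applyop (Uto u t) w) w L x.
Proof. by elim: L => //= t L ->; rewrite applyopZ. Qed.

(* A hand leaving the last site has run the full cycle [U_{n:0}], up to the scalar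
   gate [u_{n-1}], and acts on the eigenvector by a phase. *)
Lemma hand_state_wrap (t t' : 'I_n) S : t.+1 = n -> val t' = 0 -> t \in S -> t' \notin S ->
  hand_state (t' |: (S :\ t)) =
  applyop (scaleop (c * (expi phi)^*) (idop R n)) (hand_state S).
Proof.
move=> et et' tS t'S; have [L [Q [eS lL lQ]]] := enum_split S t tS.
have eQ : Q = [::].
  case: Q lQ {eS} => //= s Q /andP [lt _].
  by exfalso; move: lt (ltn_ord s) et; lia.
rewrite {}eQ {lQ} in eS.
rewrite !hand_stateE eS foldr_cat /=.
have c0 : c != 0 by rewrite -normr_gt0 hc ltr01.
(* The last gate of the cycle is the scalar [c], so the eigenvalue equation can be solved for this
   vector. *)
have -> : applyop (Uto u t) phivec = fun x => c^-1 * expi phi * phivec x.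
  have ut : u t = scaleop c (idop R n) by rewrite -hlast; congr u; move: et; lia.
  have Un k : k = t.+1 -> Uto u k = mulop (u t) (Uto u t) by move=> ->.
  apply/funext => x; move/(congr1 (fun f => f x)): heig.
  rewrite -mulrA (Un n) // ut applyop_mul applyop_scale => <-.
  by rewrite mulKf.
rewrite foldr_gates_scale applyop_scale.
(* The moved hand is now the first one, at site 0, where its factor is the identity. *)
have -> : enum (t' |: (S :\ t)) = t' :: L.
  have eL x : x \in S = (x \in L ++ [:: t]) by rewrite -eS mem_enum.
  have trans : transitive (fun s t : 'I_n => (s < t)%N) by move=> ? ? ?; apply: ltn_trans.
  apply: enum_unique => [|x].
    have := enum_sorted S; rewrite eS !(sorted_pairwise trans) pairwise_cat !pairwise_cons.
    case/and3P => _ -> _; rewrite andbT; apply/allP => s sL.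
    rewrite et' lt0n; apply: contra t'S => /eqP s0.
    by rewrite (_ : t' = s) ?eL ?mem_cat ?sL //; apply: val_inj; rewrite /= s0.
  rewrite !inE eL !mem_cat !inE.
  case: (eqVneq x t') => [//|xt'] /=.
  case: (eqVneq x t) => [->|//] /=; last by rewrite orbF.
  by apply/negbTE/negP => /(allP lL); rewrite ltnn.
rewrite /= et' /= applyop_id; apply/funext => x.
have ee : expi phi * (expi phi)^* = 1 :> C by rewrite -normCK norm_expi expr1n.
transitivity ((c / c) * (expi phi * (expi phi)^*) * foldr (fun (t : 'I_n) w =>
  applyop (Uto u t) w) phivec L x); first by rewrite ee divff // !mul1r.
by move: (foldr _ _ _ _) (_^*) => b d; ring.
Qed.

(** The operator [v] is chosen before [S]: the same unitary must act on two states that differ in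
    their other hands. *)
Lemma cyclic_hop (t t' : 'I_n) : val t' = (t.+1 %% n)%N ->
  exists v : qop R n, [/\ unitary v, local [set t; t'] v &
    forall S, t \in S -> t' \notin S ->
      hand_state (t' |: (S :\ t)) = applyop v (hand_state S)].
Proof.
move=> e; have := ltn_ord t; rewrite leq_eqVlt => /orP [/eqP et|lt].
  have et' : val t' = 0 by rewrite e et modnn.
  exists (scaleop (c * (expi phi)^*) (idop R n)); split.
  - by apply: unitary_scale; rewrite normrM norm_conjC hc norm_expi mulr1.
  - exact: local_scale.
  - by move=> S tS t'S; apply: hand_state_wrap.
rewrite modn_small // in e.
have [uu /acts_on2_local lu] := hu t lt.
exists (u t); split => //; last by move=> S tS t'S; apply: hand_state_hop.
rewrite [t in [set t; _]](_ : t = Ordinal (ltnW lt)); last exact: val_inj.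
by rewrite [t' in [set _; t']](_ : t' = Ordinal lt); last exact: val_inj.
Qed.

(** Each [Uto u t] with [t < n] is a product of unitary gates, hence injective. *)
Lemma hand_state_neq0 S x : phivec x != 0 -> exists y, hand_state S y != 0.
Proof.
rewrite hand_stateE => x0; elim: (enum S) => /= [|t s [y y0]]; first by exists x.
have : (t < n)%N by []. 
elim: (val t) => [|k IH] lt /=; first by exists y; rewrite applyop_id.
have [z z0] := IH (ltnW lt); rewrite applyop_mul.
exact: applyop_neq0 (hu k lt).1 z0.
Qed.

Section Interval.
Context (i l : nat).
Local Notation A := (cyc_interval n i l).

(** The arguments two and three share the hands of [S'] in [A], and three and four those in the
    complement. Moving each group onto the hands of [S] by local unitaries makes all four states
    equal. *)
Lemma swap_form_hand_states S S' :
  #|S :&: A| = #|S' :&: A| -> #|S :&: ~: A| = #|S' :&: ~: A| ->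
  swap_form A (hand_state S) (hand_state ((S' :&: A) :|: (S :&: ~: A)))
     (hand_state S') (hand_state ((S :&: A) :|: (S' :&: ~: A)))
  = purity A (hand_state S).
Proof.
move=> cA cB; have split X : X = (X :&: A) :|: (X :&: ~: A) by rewrite -setIUr setUCr setIT.
(* A hop of [X] inside [J] is a hop of the whole configuration, since the hands [Z] lie outside
   [J]. *)
have swapU X Z t t' (J : {set 'I_n}) : X \subset J -> Z \subset ~: J -> t \in J -> t' \in J ->
    t \in X -> t' \notin X ->
    [/\ (t' |: (X :\ t)) :|: Z = t' |: ((X :|: Z) :\ t),
        t \in X :|: Z & t' \notin X :|: Z].
  move=> sX sZ tJ t'J tX t'X; have nZ s : s \in J -> s \notin Z.
    by move=> sJ; apply/negP => /(fintype.subsetP sZ); rewrite inE sJ.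
  rewrite !inE tX negb_or t'X (nZ t') //; split => //.
  rewrite -setUA; congr (_ |: _); rewrite setDUl; congr (_ :|: _).
  by apply/setP => s; rewrite !inE; case: eqP => //= ->; apply/negbTE/nZ.
have sI X (J : {set 'I_n}) : X :&: J \subset J by apply: subsetIr.
rewrite [in X in swap_form _ _ _ X _](split S').
(* First the hands inside [A], moved simultaneously in the second and third arguments. *)
rewrite (cyc_move_invariant i l (fun X => swap_form A (hand_state S)
   (hand_state (X :|: (S :&: ~: A))) (hand_state (X :|: (S' :&: ~: A)))
   (hand_state ((S :&: A) :|: (S' :&: ~: A)))) _ _ (S :&: A)) //; last first.
  move=> t t' X e tA t'A sX tX t'X; have [v [uv lv hop]] := cyclic_hop t t' e.
  have [-> m1 n1] := swapU X (S :&: ~: A) t t' A sX (sI _ _) tA t'A tX t'X.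
  have [-> m2 n2] := swapU X (S' :&: ~: A) t t' A sX (sI _ _) tA t'A tX t'X.
  rewrite (hop _ m1 n1) (hop _ m2 n2); apply: swap_form_local => //.
  by apply: local_sub lv; rewrite subUset !sub1set tA.
rewrite -split.
(* Then the hands in the complementary interval, in the third and fourth arguments, through
   [swap_formC]. *)
rewrite (cyc_move_invariant (i + l) (n - l) (fun X => swap_form A (hand_state S)
   (hand_state S) (hand_state ((S :&: A) :|: X))
   (hand_state ((S :&: A) :|: X))) _ _ (S :&: ~: A)) -?cyc_intervalC //; last first.
  move=> t t' X e tA t'A sX tX t'X; have [v [uv lv hop]] := cyclic_hop t t' e.
  have sA : S :&: A \subset ~: (~: A) by rewrite finset.setCK.
  have [e1 m1 n1] := swapU X (S :&: A) t t' (~: A) sX sA tA t'A tX t'X.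
  rewrite finset.setUC e1 (finset.setUC _ X) (hop _ m1 n1).
  rewrite -!(swap_formC A) swap_form_local //.
  by apply: local_sub lv; rewrite subUset !sub1set tA.
by rewrite -split -purityE.
Qed.

End Interval.
End Clock.

(** * Decomposition of the purity by particle number in [A] *)

Section Assembly.
Context {R : realType} {n : nat}.
Local Notation C := R[i].

Lemma sum_qpart_fpart (V : nmodType) (G : qconf n -> fconf n -> V) :
  \sum_(c : conf (bool * bool)%type n) G (qpart c) (fpart c) = \sum_o \sum_q G q o.
Proof.
rewrite pair_big /= (reindex (fun c : conf (bool * bool)%type n => (fpart c, qpart c))) //=.
exists (fun p : fconf n * qconf n => [ffun i => (p.2 i, p.1 i)]) => [c _|[p q] _] /=.
  by apply/ffunP => i; rewrite !ffunE; case: (c i).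
by congr (_, _); apply/ffunP => i; rewrite !ffunE.
Qed.

Lemma qpart_mix A (c d : conf (bool * bool)%type n) :
  qpart (mix A c d) = mix A (qpart c) (qpart d).
Proof. by apply/ffunP => i; rewrite !ffunE; case: ifP. Qed.

Lemma fpart_mix A (c d : conf (bool * bool)%type n) :
  fpart (mix A c d) = mix A (fpart c) (fpart d).
Proof. by apply/ffunP => i; rewrite !ffunE; case: ifP. Qed.

Lemma supp_mix A (o o' : fconf n) :
  supp (mix A o o') = (supp o :&: A) :|: (supp o' :&: ~: A).
Proof.
by apply/setP => i; rewrite !inE ffunE; case: (i \in A); rewrite /= ?andbT ?andbF ?orbF.
Qed.

Context (u : nat -> qop R n) (phi : R) (phivec : qconf n -> C) (ks : seq 'I_n).
Local Notation F := (ckphi_vac phi ks).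
Local Notation st := (hand_state u phivec).

(** Each [ctup_vac S] is a basis vector, so only [S = supp (fpart c)] contributes; with a wrong
    particle number both sides vanish. *)
Lemma PsiE (c : conf (bool * bool)%type n) :
  Psi u phi phivec ks c = F (fpart c) * st (supp (fpart c)) (qpart c).
Proof.
rewrite /Psi; set o := fpart c.
have z (S : {set 'I_n}) : S != supp o -> ctup_vac S o = 0 :> C.
  by rewrite ctup_vacE; case: (eqVneq o (occupation S)) => // ->; rewrite occupationK eqxx.
case: (eqVneq #|supp o| (size ks)) => [e|ne].
  rewrite (bigD1 (supp o)) ?e //= big1 => [|S /andP [_ /z ->]]; last by rewrite mulr0.
  by rewrite addr0 varphiE suppK ctup_vacE suppK eqxx mulr1.
rewrite big1 => [|S /eqP e]; last by rewrite z ?mulr0 //; apply: contra ne => /eqP <-; rewrite e.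
have [/eqP ->|/ckphi_vac_card e] := boolP (F o == 0); first by rewrite mul0r.
by rewrite e eqxx in ne.
Qed.

Definition swap_weight A (G : fstate R n) (o o' : fconf n) : C :=
  G o * G o' * (G (mix A o' o))^* * (G (mix A o o'))^*.

(** At fixed occupations the sums over qubits form a swap form of four hand states. *)
Lemma purity_Psi A : purity A (Psi u phi phivec ks) =
  \sum_o \sum_o' swap_weight A F o o' *
    swap_form A (st (supp o)) (st (supp (mix A o' o))) (st (supp o')) (st (supp (mix A o o'))).
Proof.
rewrite purityE /swap_form.
pose T q o q' o' := swap_weight A F o o' *
  (st (supp o) q * st (supp o') q' * (st (supp (mix A o' o)) (mix A q' q))^* *
    (st (supp (mix A o o')) (mix A q q'))^*).
transitivity (\sum_c \sum_d T (qpart c) (fpart c) (qpart d) (fpart d)).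
  apply: eq_bigr => c _; apply: eq_bigr => d _.
  rewrite !PsiE !qpart_mix !fpart_mix !rmorphM /= /T /swap_weight; ring.
transitivity (\sum_c \sum_o' \sum_q' T (qpart c) (fpart c) q' o').
  apply: eq_bigr => c _; exact: (sum_qpart_fpart _ (T (qpart c) (fpart c))).
rewrite (sum_qpart_fpart _ (fun q o => \sum_o' \sum_q' T q o q' o')).
apply: eq_bigr => o _; rewrite exchange_big; apply: eq_bigr => o' _ /=.
by rewrite mulr_sumr; apply: eq_bigr => q _; rewrite mulr_sumr.
Qed.

Context (i l : nat).
Local Notation A := (cyc_interval n i l).
(** The clock dynamics enters this part through this identity, later supplied by
    [swap_form_hand_states]. *)
Context (st_purity : forall S S', #|S :&: A| = #|S' :&: A| -> #|S :&: ~: A| = #|S' :&: ~: A| ->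
  swap_form A (st S) (st ((S' :&: A) :|: (S :&: ~: A)))
     (st S') (st ((S :&: A) :|: (S' :&: ~: A))) = purity A (st S)).

Local Notation particles := (fun o => #|supp o :&: A|).

Definition block (k : nat) : fstate R n := fun o => F o * (particles o == k)%:R.

Lemma card_split (X : {set 'I_n}) : #|X| = (#|X :&: A| + #|X :&: ~: A|)%N.
Proof. by rewrite -(cardsID A X) setDE. Qed.

Lemma supp_mixI (o o' : fconf n) : supp (mix A o o') :&: A = supp o :&: A.
Proof.
by rewrite supp_mix finset.setIUl -!finset.setIA finset.setIid (finset.setIC (~: A) A) finset.setICr finset.setI0 finset.setU0.
Qed.
Lemma supp_mixIC (o o' : fconf n) : supp (mix A o o') :&: ~: A = supp o' :&: ~: A.
Proof.
by rewrite supp_mix finset.setIUl -!finset.setIA finset.setICr finset.setIid finset.setI0 finset.set0U.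
Qed.

(** The amplitudes at [o], [o'] and [mix A o' o] all require [size ks] particles; comparing the
    counts on both sides of the cut gives the equalities. *)
Lemma swap_weight_neq0 o o' : swap_weight A F o o' != 0 ->
  [/\ #|supp o| = size ks, particles o = particles o' &
      #|supp o :&: ~: A| = #|supp o' :&: ~: A|].
Proof.
rewrite /swap_weight !mulf_eq0 !conjC_eq0 !negb_or.
case/andP => /andP [/andP [/ckphi_vac_card c1 /ckphi_vac_card c2] /ckphi_vac_card c3] _.
move: c1 c2 c3; rewrite (card_split (supp o)) (card_split (supp o')).
rewrite (card_split (supp (mix A o' o))) supp_mixI supp_mixIC => c1 c2 c3.
by split=> //; lia.
Qed.

Lemma swap_weight_block k o o' : swap_weight A (block k) o o' =
  ((particles o == k) && (particles o' == k))%:R * swap_weight A F o o'.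
Proof.
rewrite /swap_weight /block !supp_mixI !rmorphM !rmorph_nat /=.
by case: (_ == k); case: (_ == k); rewrite /= ?(mul1r, mul0r, mulr1, mulr0).
Qed.

(** A nonzero weight has equal counts in [A] for [o] and [o'], so exactly one block contains it;
    counts run from 0 to [n]. *)
Lemma sum_purity_block (a : nat -> C) :
  \sum_(k < n.+1) a k * purity A (block k) =
  \sum_o \sum_o' swap_weight A F o o' * a (particles o).
Proof.
transitivity (\sum_(k < n.+1) \sum_o \sum_o' a k *
  (((particles o == k) && (particles o' == k))%:R * swap_weight A F o o')).
  apply: eq_bigr => k _; rewrite purityE mulr_sumr; apply: eq_bigr => o _.
  by rewrite mulr_sumr; apply: eq_bigr => o' _; rewrite -swap_weight_block.
rewrite exchange_big; apply: eq_bigr => o _; rewrite exchange_big; apply: eq_bigr => o' _ /=.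
have [-> |/swap_weight_neq0 [_ <- _]] := eqVneq (swap_weight A F o o') 0.
  by rewrite mul0r big1 // => k _; rewrite !mulr0.
have lt : (particles o < n.+1)%N by rewrite ltnS -[n in (_ <= n)%N]card_ord max_card.
rewrite (bigD1 (Ordinal lt)) //= eqxx mul1r mulrC big1 ?addr0 // => k ne.
by rewrite andbb [_ == _](_ : _ = false) ?mul0r ?mulr0 //; apply: contraNF ne; rewrite eq_sym.
Qed.

(** Both purities equal the same mixed swap form, up to the flip exchanging [S] and [S']. *)
Lemma purity_st_particles (S S' : {set 'I_n}) : #|S| = #|S'| -> #|S :&: A| = #|S' :&: A| ->
  purity A (st S) = purity A (st S').
Proof.
move=> e eA; have eB : #|S :&: ~: A| = #|S' :&: ~: A|.
  by move: e; rewrite (card_split S) (card_split S') eA => /addnI.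
by rewrite -(st_purity S S') // -(st_purity S' S) // swap_form_flip.
Qed.

Lemma purity_Psi_le (q : C) : 0 <= q ->
    (forall S : {set 'I_n}, #|S| = size ks -> purity A (st S) <= q) ->
  purity A (Psi u phi phivec ks) <= q * purity A F.
Proof.
move=> q0 le_q.
(* Any configuration of the sector serves as representative; the default 0 of an empty sector stays
   below [q] because [0 <= q]. *)
pose P k := if [pick S : {set 'I_n} | (#|S| == size ks) && (#|S :&: A| == k)] is Some X
            then purity A (st X) else 0.
have -> : purity A (Psi u phi phivec ks) = \sum_(k < n.+1) P k * purity A (block k).
  rewrite purity_Psi sum_purity_block; apply: eq_bigr => o _; apply: eq_bigr => o' _.
  have [->|/swap_weight_neq0 [e eA eB]] := eqVneq (swap_weight A F o o') 0.
    by rewrite !mul0r.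
  congr (_ * _); rewrite !supp_mix st_purity // /P; case: pickP => [S /andP [/eqP eS /eqP eSA]|].
    by apply: purity_st_particles; rewrite ?e ?eS.
  by move/(_ (supp o)); rewrite e !eqxx.
have -> : q * purity A F = \sum_(k < n.+1) q * purity A (block k).
  rewrite (sum_purity_block (fun=> q)) purityE mulr_sumr; apply: eq_bigr => o _.
  by rewrite mulr_sumr; apply: eq_bigr => o' _; rewrite mulrC.
apply: ler_sum => k _; apply: ler_wpM2r; first exact: purity_ge0.
by rewrite /P; case: pickP => [S /andP [/eqP eS _]|//]; apply: le_q.
Qed.

End Assembly.

(** * From purities to entropies *)

Theorem theoremA1 (R : realType) (n : nat) (hn : (2 <= n)%N)
  (u : nat -> qop R n) (c : R[i]) (hc : `|c| = 1)
  (hu : forall (t : nat) (ht : (t.+1 < n)%N),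
          unitary (u t) /\ acts_on2 (u t) (Ordinal (ltnW ht)) (Ordinal ht))
  (hlast : u n.-1 = scaleop c (idop R n))
  (phi : R) (phivec : qconf n -> R[i])
  (hnorm : \sum_(x : qconf n) `|phivec x| ^+ 2 = 1)
  (heig : applyop (Uto u n) phivec = (fun x => expi phi * phivec x))
  (ks : seq 'I_n) (hks : uniq ks)
  (i l : nat) :
  let A := cyc_interval n i l in
  renyi2 A (ckphi_vac phi ks)
    + \big[Num.min / renyi2 A (applyop (Utup u (finset.set0 : {set 'I_n})) phivec)]_(S : {set 'I_n} | (#|S| <= size ks)%N)
         renyi2 A (applyop (Utup u S) phivec)
  <= renyi2 A (Psi u phi phivec ks).
Proof.
cbv zeta; set A := cyc_interval n i l; set m := \big[_/_]_(_ | _) _.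
have [x x0] : exists x, phivec x != 0.
  apply/not_existsP => H; have /eqP := hnorm; rewrite big1 => [|x _].
    by rewrite eq_sym oner_eq0.
  by move: (H x) => /negP/negPn/eqP ->; rewrite normr0 expr0n.
have Re_ge0 (z : R[i]) : 0 <= z -> z = (complex.Re z)%:C%C.
  by rewrite lecE /= => /andP [/eqP e _]; case: z e => a b /= ->.
have [w Fw] := ckphi_vac_neq0 phi ks hks.
have [y sy] := hand_state_neq0 u hu phivec (supp w) x x0.
(* Occupation [w] has nonzero fermion amplitude and [y] nonzero qubit amplitude given these
   hands. *)
pose cc : conf (bool * bool)%type n := [ffun s => (y s, w s)].
have Psi_gt0 : 0 < purity A (Psi u phi phivec ks).
  apply: (purity_gt0 _ _ cc); rewrite PsiE.
  have -> : fpart cc = w by apply/ffunP => s; rewrite !ffunE.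
  have -> : qpart cc = y by apply/ffunP => s; rewrite !ffunE.
  by rewrite mulf_neq0.
have F_gt0 : 0 < purity A (ckphi_vac phi ks) by exact: purity_gt0 Fw.
have le_m (S : {set 'I_n}) : #|S| = size ks -> purity A (hand_state u phivec S) <= (expR (- m))%:C%C.
  move=> eS; have P0 := purity_ge0 A (hand_state u phivec S).
  (* A nonpositive value is bounded directly, since [expR] and [ln] are inverse only on positive
     numbers. *)
  rewrite (Re_ge0 _ P0) lecR; have [le0|gt0] := lerP (complex.Re (purity A (hand_state u phivec S))) 0.
    exact: le_trans le0 (expR_ge0 _).
  rewrite -[leLHS]lnK ?posrE // ler_expR lerNr.
  by apply: bigmin_le_cond; rewrite eS.
have := purity_Psi_le u phi phivec ks i l _ (expR (- m))%:C%C _ le_m.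
move=> /(_ (swap_form_hand_states u c hc hu hlast phi phivec heig i l)).
rewrite lecR expR_ge0 => /(_ isT).
rewrite (Re_ge0 _ (ltW Psi_gt0)) (Re_ge0 _ (ltW F_gt0)) -rmorphM /= lecR => le.
move: (Psi_gt0); rewrite (Re_ge0 _ (ltW Psi_gt0)) ltcR => Psi_re.
move: (F_gt0); rewrite (Re_ge0 _ (ltW F_gt0)) ltcR => F_re.
rewrite /renyi2 -[m]opprK -opprD lerN2.
(* Writing [- m] as [ln (expR (- m))] turns the claim into monotonicity of [ln] applied to the
   purity bound. *)
rewrite -[X in _ <= _ + X]expRK addrC -lnM ?posrE ?expR_gt0 //.
by rewrite ler_ln // posrE mulr_gt0 ?expR_gt0.
Qed.
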